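(* Let $d\ge2$. For any unit vectors $v_1,\dots,v_d\in\mathbb C^d$ there exists a unit vector $q\in S^{2d-1}\subset\mathbb C^d$ such that, for every integer $k$ with $1\le k\le d$, the Euclidean distance from $q$ to the (complex) linear span of any $k$ of the vectors $v_1,\dots,v_d$ is at least $\sqrt{\frac{d-k}{d}}$.
   Context: $S^{2d-1}$ is the unit sphere of $\mathbb C^d$ with its standard Hermitian norm. *)

(* Defs.v *)
From HB Require Import structures.
From mathcomp Require Import all_boot all_order all_algebra.
From mathcomp Require Import complex.
From mathcomp Require Import boolp classical_sets reals.

Set Implicit Arguments.
Unset Strict Implicit.
Unset Printing Implicit Defensive.

Import Order.TTheory GRing.Theory Num.Theory.

Local Open Scope ring_scope.
Local Open Scope complex_scope.
Local Open Scope classical_set_scope.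

(* [dotmx x x] is a complex number with zero imaginary part, hence [Re].  The
   library's own norm on ['rV[R[i]]_d] is the sup norm, so it is not used. *)
Definition hnorm2 (R : realType) (d : nat) (x : 'rV[R[i]]_d) : R :=
  Num.sqrt (complex.Re (dotmx x x)).

Definition dist_to (R : realType) (d : nat) (x : 'rV[R[i]]_d)
    (U : {vspace 'rV[R[i]]_d}) : R :=
  inf [set hnorm2 (x - w) | w in [set w : 'rV[R[i]]_d | w \in U]].

(* Main.v *)
Require Import Defs.
From HB Require Import structures.
From mathcomp Require Import all_boot all_order all_algebra.
From mathcomp Require Import cyclic separable cyclotomic.
From mathcomp Require Import complex.
From mathcomp Require Import zify ring lra.
From mathcomp Require Import boolp classical_sets reals.
From mathcomp Require Import topology normedtype derive.

Set Implicit Arguments.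
Unset Strict Implicit.
Unset Printing Implicit Defensive.

Import Order.TTheory GRing.Theory Num.Theory.
Import numFieldNormedType.Exports.

Local Open Scope ring_scope.

(* Suppose first that the v_j form a basis, and let q maximise the product of
   the moduli of its coordinates b_j over the unit sphere.  Stationarity gives
   d <b_j v_j, q> = 1 for all j.  Let p = sum_(j in K) y_j b_j v_j be the
   orthogonal projection of q on the span of the v_j, j in K.  For |z| = 1 the
   vector (q - p) + z p has norm 1, so by maximality the polynomial
   Q(z) = prod_(j in K) (1 + (z - 1) y_j), of degree at most #|K|, is bounded
   by 1 on the unit circle; Bernstein's inequality bounds Q'(1) = sum y_j by
   #|K|, and d |p|^2 = d <p, q> = sum y_j.  In general, replace v_j by
   v_j + e e_j and let e tend to 0: the inequalities
   |q - sum_(j in K) c_j v_j|^2 >= (d - #|K|) / d survive at a cluster point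
   of the unit vectors q. *)

(** * Roots of unity and Bernstein's inequality at the point 1 *)

(** The polynomial X^n - 1 is separable in characteristic 0, so it has n distinct roots, and n
    distinct n-th roots of unity in a field include a primitive one. *)
Lemma prim_root_exists (C : numClosedFieldType) n :
  (n > 0)%N -> exists z : C, n.-primitive_root z.
Proof.
move=> n_gt0; have [r Dp] := closed_field_poly_normal ('X^n - 1 : {poly C}).
rewrite (monicP _) ?monicXnsubC // scale1r in Dp.
have rn1: all n.-unity_root r by apply/allP=> z; rewrite -root_prod_XsubC -Dp.
have sz_r: (n < (size r).+1)%N.
  by rewrite -(size_prod_XsubC r id) -Dp size_XnsubC.
have [|z] := hasP (has_prim_root n_gt0 rn1 _ sz_r); last by exists z.
by rewrite -separable_prod_XsubC -Dp separable_Xn_sub_1 // pnatr_eq0 -lt0n.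
Qed.

(** Orthogonality of characters: the summands form a geometric progression whose ratio is an n-th
    root of unity, and this ratio differs from 1 when a and b differ. *)
Lemma sum_prim_root (F : fieldType) (n a b : nat) (z : F) :
  n.-primitive_root z -> (a < n)%N -> (b < n)%N ->
  \sum_(l < n) (z ^+ l) ^+ a / (z ^+ l) ^+ b = if a == b then n%:R else 0.
Proof.
move=> prim_z lt_an lt_bn.
have z_neq0 : z != 0.
  apply: contra_eq_neq (prim_expr_order prim_z) => ->.
  by rewrite expr0n (gtn_eqF (prim_order_gt0 prim_z)) eq_sym oner_eq0.
have ->: \sum_(l < n) (z ^+ l) ^+ a / (z ^+ l) ^+ b
       = \sum_(l < n) (z ^+ a / z ^+ b) ^+ l.
  by apply: eq_bigr => l _; rewrite exprMn exprVn -!exprM ![(l * _)%N]mulnC.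
case: eqVneq => [->|neq_ab].
  rewrite divff ?expf_neq0 //.
  by under eq_bigr do rewrite expr1n; rewrite sumr_const card_ord.
have zab_neq1 : z ^+ a / z ^+ b - 1 != 0.
  rewrite subr_eq0 -(inj_eq (mulIf (expf_neq0 b z_neq0))) divfK ?expf_neq0 //.
  by rewrite mul1r (eq_prim_root_expr prim_z) !modn_small.
apply: (mulfI zab_neq1); rewrite -subrX1 mulr0 exprMn exprVn -!exprM.
by rewrite !(mulnC _ n) !exprM (prim_expr_order prim_z) !expr1n divr1 subrr.
Qed.

(* M. Riesz's argument: averaging [Q(w) w^-N |1 + w + ... + w^(N-1)|^2] over
   the 2N-th roots of unity gives [Q'(1)], and the positive Fejer weights
   average to [N]. *)
Lemma bernstein (C : numClosedFieldType) (N : nat) (Q : {poly C}) :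
  (size Q <= N.+1)%N -> (forall z : C, `|z| = 1 -> `|Q.[z]| <= 1) ->
  `|Q^`().[1]| <= N%:R.
Proof.
(* For N = 0 there are no 2N-th roots to average over, but Q is then constant. *)
case: N => [|N0]; [|set N := N0.+1] => sQ Q_le1.
  by rewrite (size1_polyC sQ) derivC horner0 normr0.
have [z prim_z] := prim_root_exists C (isT : (0 < N * 2)%N).
set L := (N * 2)%N in prim_z.
have normz l : `|z ^+ l| = 1.
  rewrite normrX; have: `|z| ^+ L = 1.
    by rewrite -normrX (prim_expr_order prim_z) normr1.
  by move/eqP; rewrite pexpr_eq1 // => /eqP->; rewrite expr1n.
have z_neq0 l : z ^+ l != 0 by rewrite -normr_gt0 normz.
have conjz l m : ((z ^+ l) ^+ m)^* = ((z ^+ l) ^+ m)^-1.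
  apply: (mulfI (expf_neq0 m (z_neq0 l))).
  by rewrite -normCK divff ?(expf_neq0 m (z_neq0 l)) // normrX normz !expr1n.
pose w l := \sum_(m < N) (z ^+ l) ^+ m.
have w2 l : `|w l| ^+ 2
    = \sum_(m < N) \sum_(m' < N) (z ^+ l) ^+ m / (z ^+ l) ^+ m'.
  rewrite normCK /w rmorph_sum mulr_suml; apply: eq_bigr => m _.
  by rewrite mulr_sumr; apply: eq_bigr => m' _; rewrite -conjz.
have avg : \sum_(l < L) Q.[z ^+ l] / (z ^+ l) ^+ N * `|w l| ^+ 2
    = L%:R * Q^`().[1].
  (* Both exponents k + m and N + m' stay below 2N, so orthogonality keeps exactly the terms with k
     + m = N + m'. For given k and m' this has a solution m < N only when m' < k, so the coefficient
     of degree k is counted k times, as in Q'(1). *)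
  transitivity (\sum_(k < N.+1) \sum_(m < N) \sum_(m' < N)
      Q`_k * \sum_(l < L) (z ^+ l) ^+ (k + m) / (z ^+ l) ^+ (N + m')).
    transitivity (\sum_(l < L) \sum_(k < N.+1) \sum_(m < N) \sum_(m' < N)
      Q`_k * ((z ^+ l) ^+ (k + m) / (z ^+ l) ^+ (N + m'))).
      apply: eq_bigr => l _; rewrite (horner_coef_wide _ sQ) w2 !mulr_suml.
      apply: eq_bigr => k _; rewrite mulr_sumr; apply: eq_bigr => m _.
      rewrite mulr_sumr; apply: eq_bigr => m' _.
      by rewrite !exprD invfM; ring.
    rewrite exchange_big; apply: eq_bigr => k _.
    rewrite exchange_big; apply: eq_bigr => m _.
    by rewrite exchange_big; apply: eq_bigr => m' _; rewrite mulr_sumr.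
  rewrite (@horner_coef_wide _ N) ; last first.
    by rewrite (leq_trans (size_poly _ _)) // -subn1 leq_subLR.
  transitivity (\sum_(k < N.+1) L%:R * (Q`_k *+ k)); last first.
    rewrite big_ord_recl mulr0n mulr0 add0r mulr_sumr; apply: eq_bigr => k _.
    by rewrite coef_deriv expr1n mulr1.
  apply: eq_bigr => k _; have le_kN : (k <= N)%N by rewrite -ltnS.
  transitivity (\sum_(m' < N) L%:R * (Q`_k *+ (m' < k)%N)); last first.
    rewrite -mulr_sumr sumrMnr; congr (_ * (_ *+ _)).
    by rewrite -big_mkcond -(big_ord_widen _ (fun=> 1%N)) // sum1_card card_ord.
  rewrite exchange_big; apply: eq_bigr => m' _ /=.
  have lt_m'N := ltn_ord m'.
  under eq_bigr => m _.
    rewrite (sum_prim_root prim_z); [|have := ltn_ord m; lia|lia]; over.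
  have [lt_m'k|le_km'] := ltnP m' k; last first.
    rewrite mulr0n mulr0 big1 // => m _.
    by have := ltn_ord m; case: eqP => [|_ _]; [lia|rewrite mulr0].
  have lt_mN : (N + m' - k < N)%N by lia.
  rewrite (bigD1 (Ordinal lt_mN)) //= big1 => [|m].
    by rewrite addr0 mulr1n ifT 1?mulrC //; lia.
  by rewrite -val_eqE /= => ?; rewrite ifF ?mulr0 //; lia.
have sumw : \sum_(l < L) `|w l| ^+ 2 = L%:R * N%:R.
  under eq_bigr => l _ do rewrite w2.
  have lt_L (m : 'I_N) : (m < L)%N by have := ltn_ord m; lia.
  rewrite exchange_big /= mulr_natr -[N in RHS]card_ord -sumr_const.
  apply: eq_bigr => m _; rewrite exchange_big /= (bigD1 m) //=.
  rewrite (sum_prim_root prim_z) // eqxx [X in _ + X]big1 ?addr0 // => m'.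
  by rewrite (sum_prim_root prim_z) // -val_eqE /= eq_sym => /negPf->.
have L_gt0 : 0 < L%:R :> C by rewrite ltr0n.
rewrite -(ler_pM2l L_gt0) -sumw -[X in X * `|_|](gtr0_norm L_gt0) -normrM -avg.
apply: (le_trans (ler_norm_sum _ _ _)); apply: ler_sum => l _.
rewrite normrM normrM normfV normrX normz expr1n divr1 normrX normr_id.
by rewrite ler_piMl ?exprn_ge0 ?Q_le1.
Qed.

(** Every factor equals 1 at z = 1, so the derivative of the product at 1 is the sum of the
    derivatives y_j of the factors. *)
Lemma bernstein_prod (C : numClosedFieldType) (I : finType) (K : {set I})
    (y : I -> C) :
  (forall z, `|z| = 1 -> `|\prod_(j in K) (1 + (z - 1) * y j)| <= 1) ->
  `|\sum_(j in K) y j| <= #|K|%:R.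
Proof.
move=> y_le1; pose Q := \prod_(j in K) (1 + ('X - 1) * (y j)%:P) : {poly C}.
have Q_horner z : Q.[z] = \prod_(j in K) (1 + (z - 1) * y j).
  by rewrite horner_prod; apply: eq_bigr => j _; rewrite !hornerE.
have sQ : (size Q <= #|K|.+1)%N.
  rewrite /Q -sum1_card; elim/big_rec2: _ => [|j n p _ sp].
    by rewrite size_poly1.
  apply: leq_trans (size_polyMleq _ _) _.
  have : (size (1 + ('X - 1) * (y j)%:P)%R <= 2)%N.
    apply: leq_trans (size_polyD _ _) _; rewrite geq_max size_poly1 /=.
    apply: leq_trans (size_polyMleq _ _) _.
    by rewrite -polyC1 size_XsubC size_polyC; case: (_ != 0).
  by move=> sa; rewrite -subn1 leq_subLR (leq_trans (leq_add sa sp)) ?addSn.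
have [_ <-] : Q.[1] = 1 /\ Q^`().[1] = \sum_(j in K) y j.
  rewrite /Q; elim/big_rec2: _ => [|j p s _ [p1 p's]].
    by rewrite hornerC derivC horner0.
  by rewrite !poly.derivE !hornerE p1 p's; split; ring.
by apply: bernstein sQ _ => z /y_le1; rewrite Q_horner.
Qed.

(** * Orthogonal projections of an extremal vector *)

Section Extremal.
Variables (C : numClosedFieldType) (d : nat).
Local Notation "''[' u , v ]" := (@dotmx C d u v) : ring_scope.
Local Notation "''[' u ]" := '[u, u] : ring_scope.

(* Instances at [dotmx] of the [sesquilinear] lemmas, whose left-hand sides do
   not match [dotmx] when rewriting. *)
Lemma dotmx_ge0 u : 0 <= '[u].
Proof. exact: (@dnorm_ge0 _ _ (@dotmx C d)). Qed.

Lemma dotmxC u v : '[u, v] = ('[v, u])^*.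
Proof. by rewrite (@hermC _ _ _ _ (@dotmx C d)) expr0 mul1r. Qed.

Lemma dotmxDl u v w : '[u + v, w] = '[u, w] + '[v, w].
Proof. by rewrite linearDl. Qed.

Lemma dotmxDr u v w : '[u, v + w] = '[u, v] + '[u, w].
Proof. by rewrite linearDr. Qed.

Lemma dotmx_suml (I : finType) (F : I -> 'rV_d) v :
  '[\sum_i F i, v] = \sum_i '[F i, v].
Proof.
by apply: (big_morph (fun u => '[u, v])) => [u1 u2|]; rewrite ?dotmxDl ?linear0l.
Qed.

Lemma dotmxZl a u v : '[a *: u, v] = a * '[u, v].
Proof. by rewrite linearZl_LR. Qed.

Lemma dotmxZr a u v : '[u, a *: v] = a^* * '[u, v].
Proof. by rewrite linearZr_LR. Qed.

Lemma dotmxZ a u : '[a *: u] = `|a| ^+ 2 * '[u].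
Proof. by rewrite dotmxZl dotmxZr mulrA normCK. Qed.

Lemma dotmxDd u v : '[u, v] = 0 -> '[u + v] = '[u] + '[v].
Proof. exact: (@hnormDd _ _ _ _ (@dotmx C d)). Qed.

Lemma dotmx_orthoP (m : nat) (A : 'M[C]_(m, d)) (u w : 'rV_d) :
  u *m (A ^T ^ Num.conj)%sesqui = 0 -> (w <= A)%MS -> '[u, w] = 0.
Proof.
move=> uA0 /submxP[D ->].
by rewrite dotmxE trmx_mul map_mxM mulmxA uA0 mul0mx mxE.
Qed.

(** The projection p splits q - w into the orthogonal parts q - p and p - w, so it is enough that d
    |p|^2 <= #|K|. Stationarity turns d |p|^2 into a sum of coordinate ratios, which
    [bernstein_prod] bounds. *)
Lemma extremal_dist (V : 'M[C]_d) (q : 'rV[C]_d) :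
    let coord x j := (x *m invmx V) 0 j in
    V \in unitmx -> '[q] = 1 -> \prod_j coord q j != 0 ->
    (forall x, '[x] = 1 -> `|\prod_j coord x j| <= `|\prod_j coord q j|) ->
    (forall j, d%:R * '[coord q j *: row j V, q] = 1) ->
  forall (K : {set 'I_d}) (w : 'rV_d), (forall j, j \notin K -> coord w j = 0) ->
    d%:R - #|K|%:R <= d%:R * '[q - w].
Proof.
move=> coord Vunit q1 b_neq0 q_max q_crit K w w_supp.
(* [E] erases the coordinates outside [K], so the row space of [A] is the span of the rows of [V]
   indexed by [K]. *)
pose E : 'M[C]_d := diag_mx (\row_j (j \in K)%:R).
pose A := E *m V.
have [D pE] := submxP (proj_ortho_sub A q).
set p := q *m _ in pE.
have r_ortho : (q - p) *m (A ^T ^ Num.conj)%sesqui = 0.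
  by apply/orthomx1P; exact: proj_ortho_compl_sub.
have pA : (p <= A)%MS by rewrite pE submxMl.
have coordD x y j : coord (x + y) j = coord x j + coord y j.
  by rewrite /coord mulmxDl mxE.
have coordZ a x j : coord (a *: x) j = a * coord x j.
  by rewrite /coord -scalemxAl mxE.
have coord_supp j : j \notin K -> coord p j = 0.
  move=> /negPf jK; rewrite /coord pE /A mulmxA mulmxK // mul_mx_diag !mxE jK.
  by rewrite mulr0.
have coord_sum x : x = \sum_j coord x j *: row j V.
  by rewrite /coord -[x in LHS](mulmxKV Vunit) {1}mulmx_sum_row.
have wA : (w <= A)%MS.
  apply/submxP; exists (w *m invmx V); rewrite /A mulmxA -[w in LHS](mulmxKV Vunit).
  congr (_ *m _); apply/rowP => j; rewrite mul_mx_diag [RHS]mxE [X in _ * X]mxE -/(coord w j).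
  by have [jK|/w_supp] := boolP (j \in K); rewrite ?mulr1 // => ->; rewrite mul0r.
have rp : '[q - p, p] = 0 := dotmx_orthoP r_ortho pA.
have bj_neq0 j : coord q j != 0 by have /prodf_neq0 := b_neq0; apply.
pose y j := coord p j / coord q j.
have qp : '[q] = '[q - p] + '[p].
  by rewrite -dotmxDd ?subrK.
have sum_y : `|\sum_(j in K) y j| <= #|K|%:R.
  apply: bernstein_prod => z z1.
  (* Rotating p by a unit scalar z keeps the norm, since p is orthogonal to q - p, and multiplies
     the j-th coordinate of q by 1 + (z - 1) y_j. *)
  have : '[(q - p) + z *: p] = 1.
    rewrite dotmxDd; last first.
      by rewrite dotmxZr rp mulr0.
    by rewrite dotmxZ z1 expr1n mul1r -qp.
  move=> /q_max; have -> : \prod_j coord (q - p + z *: p) j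
      = \prod_j coord q j * \prod_(j in K) (1 + (z - 1) * y j).
    rewrite [\prod_(j in K) _]big_mkcond -big_split; apply: eq_bigr => j _ /=.
    rewrite -scaleN1r !coordD !coordZ /y; case: ifPn => [_|/coord_supp->].
      by field; exact: bj_neq0.
    by rewrite !mulr0 !addr0 mulr1.
  by rewrite normrM ger_pMr ?normr_gt0.
(* Orthogonality replaces the second p by q. Expanding the first p along the rows of [V] then leaves
   y_j times the quantity that [q_crit] sets to 1. *)
have p2 : d%:R * '[p] = \sum_(j in K) y j.
  rewrite (_ : '[p] = '[p, q]); last first.
    rewrite -[q in RHS](subrK p) dotmxDr [X in X + _](_ : _ = 0) ?add0r //.
    by rewrite dotmxC rp rmorph0.
  rewrite [p in LHS]coord_sum dotmx_suml mulr_sumr [RHS]big_mkcond.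
  apply: eq_bigr => j _ /=; case: ifPn => [_|/coord_supp->]; last first.
    by rewrite dotmxZl mul0r mulr0.
  rewrite -[RHS]mulr1 -[in RHS](q_crit j) !dotmxZl /y; field; exact: bj_neq0.
have -> : q - w = (q - p) + (p - w) by rewrite addrA subrK.
rewrite dotmxDd; last first.
  by apply: dotmx_orthoP r_ortho _; rewrite addmx_sub ?eqmx_opp.
apply: (@le_trans _ _ (d%:R * '[q - p])); last first.
  by rewrite ler_wpM2l ?ler0n // lerDl dotmx_ge0.
have -> : '[q - p] = 1 - '[p] by rewrite -q1 qp addrK.
rewrite mulrBr mulr1 lerD2l lerN2 p2 (le_trans _ sum_y) //.
(* The sum equals d |p|^2, hence is real and at most its modulus. *)
by rewrite real_ler_norm // -p2 rpredM ?realn // ger0_real ?dotmx_ge0.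
Qed.
End Extremal.

(** * First-order conditions at a maximiser *)

(** The point [c] is an interior minimum on (c - 1, c + 1), so the analytic derivative vanishes
    there, and it agrees with the formal one. *)
Lemma deriv0_of_ge0 (R : realType) (p : {poly R}) (c : R) :
  p.[c] = 0 -> (forall t, 0 <= p.[t]) -> p^`().[c] = 0.
Proof.
move=> pc0 p_ge0.
have c_in : c \in `](c - 1), (c + 1)[ by rewrite in_itv /=; apply/andP; lra.
have := @derive1_at_min R (horner p) (c - 1) (c + 1) c _ _ c_in _.
case=> [||t _|_ d0].
- lra.
- by move=> t _; exact: derivable_horner.
- by rewrite pc0.
- by rewrite derive.derivE derive1E.
Qed.

(** Both sides equal 1 at t = 0, so their difference is minimal there and its derivative 2 d a - 2 e
    vanishes. This takes the place of Lagrange multipliers. *)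
Lemma quad_le_pow (R : realType) (d : nat) (a e g h : R) :
  (forall t, 1 + 2 * e * t + h * t ^+ 2 <= (1 + 2 * a * t + g * t ^+ 2) ^+ d) ->
  e = d%:R * a.
Proof.
move=> le_t.
pose quad (a g : R) : {poly R} := 1 + (2 * a) *: 'X + g *: 'X^2.
have quadE a' g' t : (quad a' g').[t] = 1 + 2 * a' * t + g' * t ^+ 2.
  by rewrite !hornerE.
have quad' a' g' : (quad a' g')^`().[0] = 2 * a'.
  by rewrite !poly.derivE !hornerE; ring.
pose p := quad a g ^+ d - quad e h.
have pE t : p.[t] = (quad a g).[t] ^+ d - (quad e h).[t] by rewrite !hornerE.
have p'0 : p^`().[0] = 2 * a *+ d - 2 * e.
  rewrite /p derivB deriv_exp hornerD hornerN hornerMn hornerM horner_exp.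
  by rewrite !quad' !quadE !(mulr0, expr0n, addr0) expr1n mulr1.
have : p^`().[0] = 0.
  apply: deriv0_of_ge0 => [|t]; rewrite pE !quadE ?subr_ge0 ?le_t //.
  by rewrite !(mulr0, expr0n, addr0) expr1n subrr.
by rewrite p'0 -mulr_natl; lra.
Qed.

Section Homogeneous.
Variables (C : numClosedFieldType) (d : nat).
Local Notation "''[' u , v ]" := (@dotmx C d u v) : ring_scope.
Local Notation "''[' u ]" := '[u, u] : ring_scope.

(** The product is homogeneous of degree d, so normalising x carries the bound from the sphere to
    all vectors. Stationarity can then be tested along straight lines. *)
Lemma prod_coord_le (V : 'M[C]_d) (M : C) :
    let coord x j := (x *m invmx V) 0 j in
    (0 < d)%N -> 0 <= M ->
    (forall x, '[x] = 1 -> `|\prod_j coord x j| <= M) ->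
  forall x, `|\prod_j coord x j| ^+ 2 <= '[x] ^+ d * M ^+ 2.
Proof.
move=> coord d_gt0 M_ge0 leM x; have [->|x_neq0] := eqVneq x 0.
  rewrite (bigD1 (Ordinal d_gt0)) //= /coord mul0mx mxE mul0r normr0 expr0n.
  by rewrite mulr_ge0 ?exprn_ge0 ?dotmx_ge0.
have x2_gt0 : 0 < '[x] by rewrite (@dnorm_gt0 _ _ (@dotmx C d)).
have s_gt0 : 0 < sqrtC '[x] by rewrite sqrtC_gt0.
have := leM ((sqrtC '[x])^-1 *: x); rewrite dotmxZ normfV (gtr0_norm s_gt0).
rewrite exprVn sqrtCK mulVf ?gt_eqF // => /(_ erefl).
under eq_bigr => j _ do rewrite /coord -scalemxAl mxE.
rewrite big_split /= prodr_const card_ord normrM normrX normfV (gtr0_norm s_gt0).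
rewrite exprVn ler_pdivrMl ?exprn_gt0 // => le1.
rewrite -[X in X ^+ d * _]sqrtCK exprAC -exprMn lerXn2r ?nnegrE //.
by rewrite mulr_ge0 // exprn_ge0 // ltW.
Qed.
End Homogeneous.

Local Open Scope complex_scope.

Section Complex.
Variable R : realType.

Definition sqnorm (z : R[i]) : R := complex.Re z ^+ 2 + complex.Im z ^+ 2.

Lemma normC_sqnorm (z : R[i]) : `|z| ^+ 2 = (sqnorm z)%:C.
Proof.
rewrite sqr_normc /sqnorm; case: z => a b /=.
by apply/eqP; rewrite eq_complex /=; apply/andP; split; apply/eqP; ring.
Qed.

Lemma dotmx_sqnorm d (x : 'rV[R[i]]_d) :
  dotmx x x = (\sum_j sqnorm (x 0 j))%:C.
Proof.
rewrite dotmxE mxE rmorph_sum; apply: eq_bigr => j _ /=.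
by rewrite !mxE -normCK normC_sqnorm.
Qed.

Lemma dotmx_Re d (x : 'rV[R[i]]_d) : dotmx x x = (complex.Re (dotmx x x))%:C.
Proof. by rewrite dotmx_sqnorm. Qed.

(** Adding t w u to q, with u the j-th component of q in the basis, multiplies the j-th coordinate
    by 1 + t w and fixes the others. For |w| = 1, comparing |1 + t w|^2 with |q + t w u|^(2d) to
    first order in t gives Re w = d Re (w c). *)
Lemma extremal_crit d (V : 'M[R[i]]_d) (q : 'rV[R[i]]_d) :
    let coord x j := (x *m invmx V) 0 j in
    V \in unitmx -> dotmx q q = 1 -> \prod_j coord q j != 0 ->
    (forall x, dotmx x x = 1 ->
       `|\prod_j coord x j| <= `|\prod_j coord q j|) ->
  forall j, d%:R * dotmx (coord q j *: row j V) q = 1.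
Proof.
move=> coord Vunit q1 b_neq0 q_max j.
have d_gt0 : (0 < d)%N by apply: leq_ltn_trans (ltn_ord j).
have bound := prod_coord_le d_gt0 (normr_ge0 _) q_max.
set u := _ *: row j V; set c := dotmx u q.
have coordDu a k : coord (q + a *: u) k = coord q k + a * coord q j * (j == k)%:R.
  rewrite /coord mulmxDl mxE -/(coord q k); congr (_ + _).
  rewrite scalerA -scalemxAl -row_mul mulmxV // mxE -/(coord q j); congr (_ * _).
  by rewrite !mxE.
have crit w : sqnorm w = 1 -> complex.Re w = d%:R * complex.Re (w * c).
  move=> w1; apply: (@quad_le_pow _ _ _ _ (complex.Re (dotmx u u)) 1) => t.
  have := bound (q + (t%:C * w) *: u).
  have -> : \prod_k coord (q + (t%:C * w) *: u) k
      = (1 + t%:C * w) * \prod_k coord q k.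
    rewrite [in RHS](bigD1 j) // [LHS](bigD1 j) //= mulrA; congr (_ * _).
      by rewrite coordDu eqxx mulr1 mulrDl mul1r.
    apply: eq_bigr => k /negPf kj.
    by rewrite coordDu eq_sym kj mulr0 addr0.
  rewrite normrM exprMn ler_pM2r ?exprn_gt0 ?normr_gt0 //.
  have -> : dotmx (q + (t%:C * w) *: u) (q + (t%:C * w) *: u)
      = (1 + 2 * complex.Re (w * c) * t + complex.Re (dotmx u u) * t ^+ 2)%:C.
    rewrite dotmxDl !dotmxDr q1 dotmxZ dotmxZl dotmxZr (dotmxC q u) -/c.
    rewrite normrM exprMn !normC_sqnorm w1 [dotmx u u]dotmx_Re.
    move: (complex.Re _) => g; move: {w1} w c => [w1 w2] [c1 c2].
    apply/eqP; rewrite eq_complex /sqnorm /=.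
    by apply/andP; split; apply/eqP; rewrite /=; ring.
  rewrite normC_sqnorm -rmorphXn lecR; congr (_ <= _).
  move: w1; rewrite /sqnorm; case: w => [w1 w2] /= w12.
  transitivity (1 + 2 * w1 * t + (w1 ^+ 2 + w2 ^+ 2) * t ^+ 2); first by ring.
  by rewrite w12 mul1r.
(* The directions w = 1 and w = i give the real and imaginary parts of d c = 1. *)
have := crit 1; have := crit 'i.
rewrite /sqnorm /= !expr0n !expr1n addr0 add0r => /(_ erefl) Imc /(_ erefl) Rec.
move: Imc Rec; rewrite -[in d%:R * c](rmorph_nat (real_complex R)).
case: (c) => c1 c2 /= Imc Rec; apply/eqP; rewrite eq_complex /=.
by apply/andP; split; apply/eqP; move: Imc Rec; lra.
Qed.

(** Products of squared moduli have the same maximisers as products of moduli, and being real-valued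
    they suit the compactness argument. *)
Lemma sphere_extremal_dist d (V : 'M[R[i]]_d) (q : 'rV[R[i]]_d) :
    let coord x j := (x *m invmx V) 0 j in
    V \in unitmx -> dotmx q q = 1 -> \prod_j coord q j != 0 ->
    (forall x, dotmx x x = 1 ->
       \prod_j sqnorm (coord x j) <= \prod_j sqnorm (coord q j)) ->
  forall (K : {set 'I_d}) (c : 'I_d -> R[i]),
    d%:R - #|K|%:R <= d%:R * complex.Re
      (dotmx (q - \sum_(j in K) c j *: row j V) (q - \sum_(j in K) c j *: row j V)).
Proof.
move=> coord Vunit q1 b_neq0 q_max K c.
have q_max' x : dotmx x x = 1 -> `|\prod_j coord x j| <= `|\prod_j coord q j|.
  move=> /q_max; rewrite -lecR !rmorph_prod.
  under eq_bigr => j _ do rewrite /= -normC_sqnorm.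
  under [X in _ <= X]eq_bigr => j _ do rewrite /= -normC_sqnorm.
  by rewrite !prodrXl -!normr_prod ler_pXn2r ?nnegrE.
rewrite -lecR rmorphB rmorphM !rmorph_nat /= -dotmx_Re.
have q_crit := extremal_crit Vunit q1 b_neq0 q_max'.
apply: (extremal_dist Vunit q1 b_neq0 q_max' q_crit).
move=> j jK; rewrite mulmx_suml summxE big1 // => k kK.
rewrite -scalemxAl -row_mul mulmxV // !mxE; case: eqP jK => [<-|_ _].
  by rewrite kK.
by rewrite mulr0.
Qed.
End Complex.

(** * Continuity and compactness in real coordinates *)

Section Sphere.
Variables (R : realType) (d : nat).

(* Topology is only used on the real coordinates: [R[i]] is not known to be
   locally compact by the library. *)
Definition of_reals (x : 'rV[R]_(d + d)) : 'rV[R[i]]_d :=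
  \row_j (x 0 (lshift d j) +i* x 0 (rshift d j)).

Definition to_reals (z : 'rV[R[i]]_d) : 'rV[R]_(d + d) :=
  row_mx (\row_j complex.Re (z 0 j)) (\row_j complex.Im (z 0 j)).

Lemma to_realsK : cancel to_reals of_reals.
Proof.
move=> z; apply/rowP => j; rewrite mxE row_mxEl row_mxEr !mxE.
by case: (z 0 j).
Qed.

Definition sphere := [set x : 'rV[R]_(d + d) |
  complex.Re (dotmx (of_reals x) (of_reals x)) = 1]%classic.

Lemma continuous_sum (T : topologicalType) (I : finType) (f : I -> T -> R) :
  (forall i, continuous (f i)) -> continuous (fun x => \sum_i f i x).
Proof.
by move=> cf; apply: continuous_big => [|i _]; [exact: add_continuous|exact: cf].
Qed.

Lemma continuous_prod (T : topologicalType) (I : finType) (f : I -> T -> R) :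
  (forall i, continuous (f i)) -> continuous (fun x => \prod_i f i x).
Proof.
by move=> cf; apply: continuous_big => [|i _]; [exact: mul_continuous|exact: cf].
Qed.

Lemma continuous_add (T : topologicalType) (f g : T -> R) :
  continuous f -> continuous g -> continuous (fun x => f x + g x).
Proof. by move=> cf cg x; apply: cvgD; [exact: cf|exact: cg]. Qed.

Lemma continuous_mul (T : topologicalType) (f g : T -> R) :
  continuous f -> continuous g -> continuous (fun x => f x * g x).
Proof. by move=> cf cg x; apply: cvgM; [exact: cf|exact: cg]. Qed.

Lemma continuous_addC (T : topologicalType) (f : T -> R) (a : R) :
  continuous f -> continuous (fun x => f x + a).
Proof. by move=> cf; apply: continuous_add => //; exact: cst_continuous. Qed.

Lemma continuous_mulC (T : topologicalType) (f : T -> R) (a : R) :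
  continuous f -> continuous (fun x => f x * a).
Proof. by move=> cf; apply: continuous_mul => //; exact: cst_continuous. Qed.

Lemma continuous_sqnorm (T : topologicalType) (f : T -> R[i]) :
  continuous (fun x => complex.Re (f x)) ->
  continuous (fun x => complex.Im (f x)) -> continuous (fun x => sqnorm (f x)).
Proof.
move=> cRe cIm; rewrite /sqnorm; under eq_fun do rewrite !expr2.
by apply: continuous_add; apply: continuous_mul.
Qed.

(** The real and imaginary parts are real linear forms in the 2d real variables. *)
Lemma continuous_sqnorm_coord (W : 'M[R[i]]_d) j :
  continuous (fun x => sqnorm ((of_reals x *m W) 0 j)).
Proof.
have ReE x : complex.Re ((of_reals x *m W) 0 j)
    = \sum_k (x 0 (lshift d k) * complex.Re (W k j)
            + x 0 (rshift d k) * - complex.Im (W k j)).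
  rewrite mxE raddf_sum; apply: eq_bigr => k _.
  by rewrite mxE; case: (W k j) => a b /=; rewrite ?mulrN.
have ImE x : complex.Im ((of_reals x *m W) 0 j)
    = \sum_k (x 0 (lshift d k) * complex.Im (W k j)
            + x 0 (rshift d k) * complex.Re (W k j)).
  rewrite mxE raddf_sum; apply: eq_bigr => k _.
  by rewrite mxE; case: (W k j) => a b /=; rewrite ?mulrN.
apply: continuous_sqnorm.
  under eq_fun do rewrite ReE.
  apply: continuous_sum => k.
  by apply: continuous_add; apply: continuous_mulC; exact: coord_continuous.
under eq_fun do rewrite ImE.
apply: continuous_sum => k.
by apply: continuous_add; apply: continuous_mulC; exact: coord_continuous.
Qed.

Lemma continuous_sqdist (w : 'rV[R[i]]_d) :
  continuous (fun x => complex.Re (dotmx (of_reals x - w) (of_reals x - w))).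
Proof.
under eq_fun do rewrite dotmx_sqnorm /=.
apply: continuous_sum => j; apply: continuous_sqnorm.
  have -> : (fun x => complex.Re ((of_reals x - w) 0 j))
      = (fun x => x 0 (lshift d j) - complex.Re (w 0 j)).
    by apply/funext => y; rewrite !mxE; case: (w 0 j).
  by apply: continuous_addC; exact: coord_continuous.
have -> : (fun x => complex.Im ((of_reals x - w) 0 j))
    = (fun x => x 0 (rshift d j) - complex.Im (w 0 j)).
  by apply/funext => y; rewrite !mxE; case: (w 0 j).
by apply: continuous_addC; exact: coord_continuous.
Qed.

(** Heine-Borel: every real coordinate is at most 1 in absolute value, and the sphere is a level set
    of a continuous function. *)
Lemma compact_sphere : compact sphere.
Proof.
apply: bounded_closed_compact.
  exists 1; split=> // M M1 x x1; apply: le_trans (ltW M1).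
  rewrite [leLHS]/Num.norm /= mx_normrE; apply/bigmax_leP; split=> //= -[i j] _ /=.
  move: x1; rewrite /sphere /= dotmx_sqnorm /= => x1.
  have sqj (k : 'I_d) : sqnorm (of_reals x 0 k) <= 1.
    rewrite -x1 (bigD1 k) //= lerDl sumr_ge0 // => l _.
    by rewrite /sqnorm addr_ge0 ?sqr_ge0.
  rewrite -[leRHS](@normr1 R) -ler_sqr ?nnegrE // !real_normK ?num_real // expr1n ord1.
  case: (splitP j) => k jk; have := sqj k; rewrite /sqnorm !mxE /=.
    by apply: le_trans; rewrite (_ : j = lshift d k) ?lerDl ?sqr_ge0 //; apply: val_inj.
  by apply: le_trans; rewrite (_ : j = rshift d k) ?lerDr ?sqr_ge0 //; apply: val_inj.
have -> : sphere = ((fun x => complex.Re (dotmx (of_reals x - 0) (of_reals x - 0)))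
    @^-1` [set x | x = 1])%classic.
  by apply/seteqP; split => x; rewrite /sphere /= subr0.
by apply: preimage_closed; [move=> x _; exact: continuous_sqdist|exact: closed_eq].
Qed.
End Sphere.

(** * Existence of maximisers and passage to the limit *)

Section Existence.
Variables (R : realType) (d : nat).
Local Notation sqdist u w := (complex.Re (dotmx (u - w) (u - w))).

(** The extreme value theorem gives a maximiser. The maximum is positive because the normalised sum
    [a *: u] of the rows of [V] has all its coordinates nonzero. *)
Lemma exists_sphere_max (V : 'M[R[i]]_d) :
    let coord x j := (x *m invmx V) 0 j in
    (0 < d)%N -> V \in unitmx ->
  exists2 x, sphere x & \prod_j coord (of_reals x) j != 0 /\
    forall z, dotmx z z = 1 ->
      \prod_j sqnorm (coord z j) <= \prod_j sqnorm (coord (of_reals x) j).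
Proof.
move=> coord d_gt0 Vunit.
have sphereP z : dotmx z z = 1 -> @sphere R d (to_reals z).
  by move=> z1; rewrite /sphere /= to_realsK z1.
pose u : 'rV[R[i]]_d := const_mx 1 *m V.
have coord_u j : coord u j = 1 by rewrite /coord mulmxK // mxE.
have u2_gt0 : 0 < dotmx u u.
  rewrite (@dnorm_gt0 _ _ (@dotmx R[i] d)); apply/eqP => u0.
  have := coord_u (Ordinal d_gt0); rewrite /coord u0 mul0mx mxE => /eqP.
  by rewrite eq_sym oner_eq0.
pose a := (sqrtC (dotmx u u))^-1.
have a_neq0 : a != 0 by rewrite invr_eq0 sqrtC_eq0 gt_eqF.
have au1 : dotmx (a *: u) (a *: u) = 1.
  rewrite dotmxZ normfV exprVn ger0_norm ?sqrtC_ge0 1?ltW // sqrtCK.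
  by rewrite mulVf ?gt_eqF.
have coord_au j : coord (a *: u) j = a.
  by rewrite /coord -scalemxAl mxE -/(coord u j) coord_u mulr1.
have sqnorm_gt0 z : z != 0 -> 0 < @sqnorm R z.
  by move=> z_neq0; rewrite -ltcR -normC_sqnorm exprn_gt0 // normr_gt0.
pose f x := \prod_j sqnorm (coord (@of_reals R d x) j).
have cf : continuous f.
  by apply: continuous_prod => j; exact: continuous_sqnorm_coord.
have [||x] := @EVT_max_rV R _ f (@sphere R d) _ (@compact_sphere R d).
- by exists (to_reals (a *: u)); exact: sphereP.
- exact: continuous_subspaceT.
move=> /set_mem Sx x_max; exists x; first exact: Sx.
split; last first.
  move=> z /sphereP; rewrite -[in X in _ -> X](to_realsK z) => Sz.
  exact: x_max (mem_set Sz).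
have : 0 < f x.
  apply: lt_le_trans (x_max (to_reals (a *: u)) _); last exact/mem_set/sphereP.
  rewrite /f to_realsK prodr_gt0 // => j _.
  by rewrite coord_au sqnorm_gt0.
apply: contraTneq => /eqP/prodf_eq0[j _ /eqP xj0].
by rewrite /f (bigD1 j) //= xj0 /sqnorm /= expr0n addr0 mul0r ltxx.
Qed.

(** The perturbed matrix is singular only if e is an eigenvalue of -V. The candidates 1 / (n + 1 +
    k) number one more than the degree of the characteristic polynomial, so one of them is not a
    root. *)
Lemma unitmx_perturb (V : 'M[R[i]]_d) (n : nat) :
  exists2 e : R, 0 < e <= n.+1%:R^-1 & V + (e%:C)%:M \in unitmx.
Proof.
pose p := char_poly (- V); have p_neq0 : p != 0 by rewrite monic_neq0 ?char_poly_monic.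
pose s : seq R[i] := [seq ((n.+1 + k)%:R^-1)%:C | k <- iota 0 (size p)].
have us : uniq s.
  rewrite map_inj_uniq ?iota_uniq // => k l /complexI /invr_inj /eqP.
  by rewrite eqr_nat eqn_add2l => /eqP.
have : ~~ all (root p) s.
  by apply/negP => /(max_poly_roots p_neq0)/(_ us); rewrite size_map size_iota ltnn.
case/allPn => z /mapP[k _ ->]; set e := _^-1 => e_root; exists e.
  by rewrite invr_gt0 ltr0n lef_pV2 ?posrE ?ltr0n // ler_nat leq_addr.
move: e_root; rewrite -eigenvalue_root_char /eigenvalue /eigenspace negbK.
by rewrite kermx_eq0 row_free_unit -opprD -scaleN1r unitmxZ ?unitrN1.
Qed.

(** The right side minus the left is t |a + u|^2, which is checked on each real coordinate. *)
Lemma sqdist_perturb (a u : 'rV[R[i]]_d) (t : R) : 0 <= t ->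
  sqdist a (t%:C *: u) <=
    (1 + t) * complex.Re (dotmx a a) + (t + t ^+ 2) * complex.Re (dotmx u u).
Proof.
move=> t_ge0; rewrite !dotmx_sqnorm /= !mulr_sumr -big_split.
apply: ler_sum => j _ /=; rewrite !mxE /sqnorm.
case: (a 0 j) (u 0 j) => [a1 a2] [u1 u2] /=.
have h (b1 b2 : R) : (b1 - t * b2) ^+ 2 <= (1 + t) * b1 ^+ 2 + (t + t ^+ 2) * b2 ^+ 2.
  rewrite -subr_ge0 (_ : _ - _ = t * (b1 + b2) ^+ 2); last by ring.
  by rewrite mulr_ge0 ?sqr_ge0.
have := lerD (h a1 u1) (h a2 u2); congr (_ <= _); ring.
Qed.

Lemma exists_far_unit_vector (v : 'I_d -> 'rV[R[i]]_d) : (0 < d)%N ->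
  exists2 q : 'rV[R[i]]_d, complex.Re (dotmx q q) = 1 &
    forall (K : {set 'I_d}) (c : 'I_d -> R[i]),
      d%:R - #|K|%:R <= d%:R * sqdist q (\sum_(j in K) c j *: v j).
Proof.
move=> d_gt0; have [V VE] : exists V, forall j, row j V = v j.
  by exists (\matrix_j v j) => j; rewrite rowK.
(* The pair holds a maximiser for the perturbed basis and the size of the perturbation. *)
pose approx n (xe : 'rV[R]_(d + d) * R) := [/\ sphere xe.1, 0 < xe.2 <= n.+1%:R^-1 &
  forall (K : {set 'I_d}) (c : 'I_d -> R[i]), d%:R - #|K|%:R <=
    d%:R * sqdist (of_reals xe.1) (\sum_(j in K) c j *: (v j + (xe.2)%:C *: 'e_j))].
have approx_ex n : exists xe, approx n xe.
  have [e e_lt Vunit] := unitmx_perturb V n.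
  have [x Sx [x_neq0 x_max]] := exists_sphere_max d_gt0 Vunit.
  exists (x, e); split=> //= K c.
  have x1 : dotmx (of_reals x) (of_reals x) = 1 by rewrite dotmx_Re Sx.
  have rowE j : row j (V + (e%:C)%:M) = v j + e%:C *: 'e_j.
    by rewrite -scalemx1 linearD linearZ /= VE row1.
  have := sphere_extremal_dist Vunit x1 x_neq0 x_max K c.
  by have -> : \sum_(j in K) c j *: row j (V + (e%:C)%:M)
      = \sum_(j in K) c j *: (v j + e%:C *: 'e_j)
    by apply: eq_bigr => j _; rewrite rowE.
have [xe xeP] := boolp.choice approx_ex.
have [q [Sq q_cluster]] : (@sphere R d `&` cluster (fst \o xe @ \oo) !=set0)%classic.
  by apply: compact_sphere; exists 0%N => // n _ /=; have [] := xeP n.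
exists (of_reals q) => // K c; set w := \sum_(j in K) _.
pose u := \sum_(j in K) c j *: 'e_j : 'rV[R[i]]_d.
have wE (e : R) : \sum_(j in K) c j *: (v j + e%:C *: 'e_j) = w + e%:C *: u.
  rewrite /w /u scaler_sumr -big_split; apply: eq_bigr => j _ /=.
  by rewrite scalerDr !scalerA mulrC.
rewrite leNgt; apply/negP => far.
pose m : R := d%:R - #|K|%:R; rewrite -/m in far.
have d0 : 0 < d%:R :> R by rewrite ltr0n.
have Gm : sqdist (of_reals q) w < m / d%:R by rewrite ltr_pdivlMr // mulrC.
(* If the bound fails at q, some [G'] lies strictly between the squared distance and m / d, leaving
   room for the error of the perturbation. *)
have [G' Gq G'm] : exists2 G', sqdist (of_reals q) w < G' & d%:R * G' < m.
  exists ((sqdist (of_reals q) w + m / d%:R) / 2); first by rewrite (midf_lt Gm).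
  by rewrite mulrC -ltr_pdivlMr // (midf_lt Gm).
have sq_ge0 (z : 'rV[R[i]]_d) : 0 <= complex.Re (dotmx z z).
  by rewrite -lecR -dotmx_Re dotmx_ge0.
have G'0 : 0 < G' by apply: le_lt_trans Gq; exact: sq_ge0.
pose U := complex.Re (dotmx u u); have U0 : 0 <= U by exact: sq_ge0.
(* For e <= 1 one has e + e^2 <= 2 e, so [e * B] bounds what the perturbation adds to
   [d%:R * G']. *)
pose B : R := d%:R * (G' + 2 * U).
have B_ge0 : 0 <= B by rewrite mulr_ge0 ?addr_ge0 ?mulr_ge0 // ltW.
have gap : 0 < m - d%:R * G' by rewrite subr_gt0.
have [N N_large] : exists N, B < N%:R * (m - d%:R * G').
  exists (Num.bound (B / (m - d%:R * G'))).
  by rewrite -ltr_pdivrMr // archi_boundP // divr_ge0 // ltW.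
(* The cluster property yields an index n >= N whose maximiser is still within squared distance [G']
   of w. The same coefficients [c] then contradict the bound for the perturbed vectors. *)
have [||_ [[n Nn <-] /= nG']] := q_cluster [set (xe n).1 | n in [set n | (N <= n)%N]]%classic
  [set x | sqdist (of_reals x) w < G']%classic.
- by exists N => // n Nn; exists n.
- by have := @continuous_sqdist R d w q _ (lt_nbhsl Gq).
have [_ /andP[e0 eN] /(_ K c)] := xeP n; rewrite wE -/m.
move: (xe n) nG' e0 eN => [x e] /= nG' e0 eN.
have e1 : e <= 1 by rewrite (le_trans eN) // invf_le1 ?ler1n ?ltr0n.
have e_small : e * B < m - d%:R * G'.
  apply: le_lt_trans (ler_wpM2r B_ge0 eN) _.
  rewrite mulrC ltr_pdivrMr ?ltr0n // mulrC (lt_le_trans N_large) //.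
  by rewrite ler_wpM2r ?(ltW gap) // ler_nat ltnW.
apply/negP; rewrite -ltNge opprD addrA.
have h := sqdist_perturb (of_reals x - w) u (ltW e0).
have : d%:R * sqdist (of_reals x - w) (e%:C *: u) <= d%:R * G' + e * B.
  have -> : d%:R * G' + e * B = d%:R * ((1 + e) * G' + (e + e) * U).
    by rewrite /B; ring.
  rewrite ler_wpM2l ?ler0n // (le_trans h) // lerD //.
    by rewrite ler_wpM2l ?(ltW nG') // addr_ge0 // ltW.
  by rewrite ler_wpM2r // lerD2l expr2 ger_pMl.
by move=> /le_lt_trans; apply; rewrite addrC -ltrBrDr.
Qed.
End Existence.

(** * From linear combinations to the distance from a span *)

Theorem corollary1p8 (R : realType) (d : nat) (hd : (2 <= d)%N)
    (v : 'I_d -> 'rV[R[i]]_d) (hv : forall i : 'I_d, hnorm2 (v i) = 1) :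
  exists q : 'rV[R[i]]_d,
    hnorm2 q = 1 /\
    forall k : nat, (1 <= k <= d)%N ->
      forall K : {set 'I_d}, #|K| = k ->
        Num.sqrt ((d%:R - k%:R) / d%:R) <= dist_to q <<[seq v i | i in K]>>%VS.
Proof.
have d_gt0 : (0 < d)%N by apply: leq_trans hd.
have [q q1 q_far] := exists_far_unit_vector v d_gt0.
exists q; split=> [|k _ K <-]; first by rewrite /hnorm2 q1 sqrtr1.
(* The infimum is bounded below by its lower bounds only for a nonempty set, and 0 in the span
   supplies an element. *)
apply: lb_le_inf; first by exists (hnorm2 (q - 0)), 0 => //; exact: mem0v.
move=> _ [w /= w_span <-].
(* The span is a sum of lines indexed by [K], so coefficients indexed by [K] exist even when the
   vectors repeat or are dependent. *)
have [c ->] : exists c, w = \sum_(j in K) c j *: v j.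
  move: w_span; rewrite span_def big_map big_enum /= => /memv_sumP[f fv ->].
  have f_line j : exists a, j \in K -> f j = a *: v j.
    have [/fv/vlineP[a ->]|_] := boolP (j \in K); first by exists a.
    by exists 0.
  by have [c fE] := boolp.choice f_line; exists c; apply: eq_bigr.
by rewrite ler_wsqrtr // ler_pdivrMr ?ltr0n // mulrC.
Qed.
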